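(* Let $(X,\mathcal{M},\mu,T)$ be an invertible measure preserving system, let $P_1,\ldots,P_\ell\in\mathbb{Z}[n]$ be polynomials with $P_i(0)=0$ for all $1\le i\le \ell$, and let $A\in\mathcal{M}$. For every $\varepsilon>0$ there exists $n\in\mathbb{N}$ such that $$\mu(A\cap T^{-P_i(n)}A)>\mu(A)^2-\varepsilon\qquad\text{for all } 1\le i\le \ell .$$
   Context: An invertible measure preserving system $(X,\mathcal{M},\mu,T)$ consists of a probability space $(X,\mathcal{M},\mu)$ and an invertible, bi-measurable map $T:X\to X$ with $\mu(T^{-1}B)=\mu(B)$ for all $B\in\mathcal{M}$. $\mathbb{N}=\{1,2,3,\ldots\}$. No linear independence of the polynomials is assumed. *)

(* Defs.v *)
From HB Require Import structures.
From mathcomp Require Import all_boot all_order all_algebra.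
From mathcomp Require Import all_classical all_reals all_analysis.

Set Implicit Arguments.
Unset Strict Implicit.
Unset Printing Implicit Defensive.

Import Order.TTheory GRing.Theory Num.Theory.

Local Open Scope classical_set_scope.

(* The inverse of T is carried explicitly: the two cancellation laws determine
   it, and its measurability is the second half of bi-measurability. *)
Record invertible_mps (d : measure_display) (X : measurableType d)
    (R : realType) (mu : probability X R) (T Tinv : X -> X) : Prop := {
  mpsK : cancel T Tinv ;
  mpsVK : cancel Tinv T ;
  mps_measurable : measurable_fun [set: X] T ;
  mpsV_measurable : measurable_fun [set: X] Tinv ;
  mps_preserving : forall B : set X, measurable B -> mu (T @^-1` B) = mu B
}.

(* T^k for k : int, where Tinv is the inverse of T; Negz m is -(m + 1). *)
Definition iterz (X : Type) (T Tinv : X -> X) (k : int) : X -> X :=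
  match k with
  | Posz m => iter m T
  | Negz m => iter m.+1 Tinv
  end.

(* Main.v *)
(* Let psi(m) = mu(A n T^{-m} A) - mu(A)^2, a positive definite function on Z, and
   x_i(n) = psi(P_i(n)).  Each product of the x_i is Phi(v(n)) for a positive
   definite Phi on Z^l and a polynomial sequence v with v(0) = 0, and along
   multiples of q! the mean of Phi(v(n)) is nonnegative in the limit: if b is the
   top coefficient of v, split off the part of Phi that is periodic along a
   multiple of b, where v loses its top term, and treat the rest with van der
   Corput's inequality.  So all mixed moments of the x_i are nonnegative.
   Weights (1 + x_i)^{k_i} with suitably decreasing k_i then have mean at least 1
   and give little mass to the event that some x_i <= - eps, so the x_i are
   simultaneously greater than - eps somewhere. *)
Require Import Defs.
From HB Require Import structures.
From mathcomp Require Import all_boot all_order all_algebra.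
From mathcomp Require Import all_classical all_reals all_analysis.
From mathcomp Require Import measurable_realfun ring lra zify.

Set Implicit Arguments.
Unset Strict Implicit.
Unset Printing Implicit Defensive.

Import Order.TTheory GRing.Theory Num.Theory.
Import numFieldNormedType.Exports.

Local Open Scope classical_set_scope.
Local Open Scope ring_scope.

(** * Positive functionals and limits along an ultrafilter *)

(** One interface for ultralimits, Cesaro means, integrals and weighted functionals: [I] is total,
    but linear and positive only on the domain [D]. *)
Record posfun (R : realType) (V : Type) (D : (V -> R) -> Prop)
    (I : (V -> R) -> R) : Prop := PosFun {
  posfun_dom1 : D (fun=> 1) ;
  posfun_dom : forall a u v, D u -> D v -> D (fun x => a * u x + v x) ;
  posfun_lin : forall a u v, D u -> D v ->
    I (fun x => a * u x + v x) = a * I u + I v ;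
  posfun_ge0 : forall u, D u -> (forall x, 0 <= u x) -> 0 <= I u
}.

Section PosFunTheory.
Context (R : realType) (V : Type) (D : (V -> R) -> Prop).
Context (I : (V -> R) -> R) (hI : posfun D I).
Implicit Types (u v : V -> R) (a : R).

Lemma posfun_dom0 : D (fun=> 0).
Proof.
have := posfun_dom hI (-1) (posfun_dom1 hI) (posfun_dom1 hI).
by under eq_fun do rewrite mulr1 addNr.
Qed.

Lemma posfun_eq0 : I (fun=> 0) = 0.
Proof.
have := posfun_lin hI (-1) posfun_dom0 posfun_dom0.
under eq_fun do rewrite mulr0 addr0.
by move=> ->; ring.
Qed.

Lemma posfun_domZ a u : D u -> D (fun x => a * u x).
Proof.
move=> Du; have := posfun_dom hI a Du posfun_dom0.
by under eq_fun do rewrite addr0.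
Qed.

Lemma posfunZ a u : D u -> I (fun x => a * u x) = a * I u.
Proof.
move=> Du; have := posfun_lin hI a Du posfun_dom0.
by under eq_fun do rewrite addr0; rewrite posfun_eq0 addr0.
Qed.

Lemma posfun_domD u v : D u -> D v -> D (fun x => u x + v x).
Proof.
move=> Du Dv; have := posfun_dom hI 1 Du Dv.
by under eq_fun do rewrite mul1r.
Qed.

Lemma posfunD u v : D u -> D v -> I (fun x => u x + v x) = I u + I v.
Proof.
move=> Du Dv; have := posfun_lin hI 1 Du Dv.
by under eq_fun do rewrite mul1r; rewrite mul1r.
Qed.

Lemma posfun_domB u v : D u -> D v -> D (fun x => u x - v x).
Proof.
move=> Du Dv; apply: posfun_domD => //.
by under eq_fun do rewrite -mulN1r; exact: posfun_domZ.
Qed.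

Lemma posfunB u v : D u -> D v -> I (fun x => u x - v x) = I u - I v.
Proof.
move=> Du Dv; have /= := posfun_lin hI (-1) Dv Du.
by under eq_fun do rewrite mulN1r addrC; rewrite mulN1r addrC.
Qed.

Lemma posfun_le u v : D u -> D v -> (forall x, u x <= v x) -> I u <= I v.
Proof.
move=> Du Dv uv; rewrite -subr_ge0 -posfunB//.
apply: (posfun_ge0 hI); first exact: posfun_domB.
by move=> x; rewrite subr_ge0.
Qed.

Lemma posfun_dom_cst a : D (fun=> a).
Proof.
have := posfun_domZ a (posfun_dom1 hI).
by under eq_fun do rewrite mulr1.
Qed.

Lemma posfun_cst a : I (fun=> a) = a * I (fun=> 1).
Proof.
have := posfunZ a (posfun_dom1 hI).
by under eq_fun do rewrite mulr1.
Qed.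

Lemma posfun_dom_sum (J : Type) (s : seq J) (c : J -> R) (u : J -> V -> R) :
  (forall j, D (u j)) -> D (fun x => \sum_(j <- s) c j * u j x).
Proof.
move=> Du; elim: s => [|j s IH].
  by under eq_fun do rewrite big_nil; exact: posfun_dom0.
by under eq_fun do rewrite big_cons; apply: (posfun_dom hI).
Qed.

Lemma posfun_sum (J : Type) (s : seq J) (c : J -> R) (u : J -> V -> R) :
  (forall j, D (u j)) ->
  I (fun x => \sum_(j <- s) c j * u j x) = \sum_(j <- s) c j * I (u j).
Proof.
move=> Du; elim: s => [|j s IH].
  by under eq_fun do rewrite big_nil; rewrite big_nil posfun_eq0.
under eq_fun do rewrite big_cons.
by rewrite big_cons (posfun_lin hI)// ?IH//; exact: posfun_dom_sum.
Qed.

End PosFunTheory.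

Definition bdd (R : realType) (u : nat -> R) := exists C : R, forall n, `|u n| <= C.

Lemma bdd_cst (R : realType) (c : R) : bdd (fun=> c).
Proof. by exists `|c|. Qed.

Lemma bdd_lin (R : realType) (a : R) u v :
  bdd u -> bdd v -> bdd (fun n => a * u n + v n).
Proof.
move=> [C hC] [K hK]; exists (`|a| * C + K) => n.
by rewrite (le_trans (ler_normD _ _))// lerD// normrM ler_wpM2l.
Qed.

Lemma bddM (R : realType) (u v : nat -> R) :
  bdd u -> bdd v -> bdd (fun n => u n * v n).
Proof.
by move=> [C hC] [K hK]; exists (C * K) => n; rewrite normrM ler_pM.
Qed.

Lemma bdd_comp (R : realType) (u : nat -> R) f : bdd u -> bdd (fun n => u (f n)).
Proof. by move=> [C hC]; exists C. Qed.

Lemma nat_ultrafilter_ex :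
  exists U : set_system nat, UltraFilter U /\ \oo `<=` U.
Proof. exact: ultraFilterLemma. Qed.

(** An ultrafilter refining the cofinite filter gives every bounded sequence a limit and agrees with
    ordinary limits. *)
Definition natultra : set_system nat := sval (cid nat_ultrafilter_ex).

Lemma natultraP : UltraFilter natultra /\ \oo `<=` natultra.
Proof. exact: (svalP (cid nat_ultrafilter_ex)). Qed.

#[global] Instance natultra_proper : ProperFilter natultra.
Proof. by have [[]] := natultraP. Qed.

Definition ulim (R : realType) (u : nat -> R) : R := lim (u @ natultra).

(** Compactness of [-C, C] gives a cluster point, and an ultrafilter converges to each of its
    cluster points. *)
Lemma cvg_ulim (R : realType) (u : nat -> R) :
  bdd u -> u @ natultra --> ulim u.
Proof.
move=> [C hC]; apply/cvg_ex.
have [] := @segment_compact R (- C) C (u @ natultra).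
  apply: (@filterS _ natultra _ setT) => [n _ /=|]; last exact: filterT.
  by rewrite in_itv/= -ler_norml; exact: hC.
move=> p [_ clp]; exists p => N Np.
have [UU _] := natultraP.
have [//|Nu] := in_ultra_setVsetC (u @^-1` N) UU.
have [x [/= Nx Nx']] := clp (~` N) N Nu Np.
by [].
Qed.

Lemma posfun_ulim (R : realType) : posfun (@bdd R) (@ulim R).
Proof.
split.
- exact: bdd_cst.
- exact: bdd_lin.
- move=> a u v bu bv; apply: cvg_lim => //.
  by apply: cvgD; [apply: cvgMr; exact: cvg_ulim|exact: cvg_ulim].
- move=> u bu u0; apply: limr_ge; first by apply/cvg_ex; exists (ulim u); exact: cvg_ulim.
  by apply: nearW.
Qed.

Lemma ulim_cst (R : realType) (c : R) : ulim (fun=> c) = c.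
Proof. by apply: cvg_lim => //; exact: cvg_cst. Qed.

Lemma ulim_cvg (R : realType) (u : nat -> R) (c : R) :
  u @ \oo --> c -> ulim u = c.
Proof.
move=> uc; apply: cvg_lim => // N /uc.
by have [_] := natultraP; apply.
Qed.

Lemma ulim_ge (R : realType) (u : nat -> R) (c : R) n0 :
  bdd u -> (forall n, (n0 <= n)%N -> c <= u n) -> c <= ulim u.
Proof.
move=> bu cu; apply: limr_ge; first by apply/cvg_ex; exists (ulim u); exact: cvg_ulim.
by have [_] := natultraP; apply; exists n0.
Qed.

Lemma ulim_harmonic (R : realType) (u v : nat -> R) (K : R) : bdd u -> bdd v ->
  (forall n, `|u n - v n| <= K * n.+1%:R^-1) -> ulim u = ulim v.
Proof.
move=> bu bv uv; apply/eqP; rewrite -subr_eq0; apply/eqP.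
rewrite -(posfunB (posfun_ulim R))//.
apply: ulim_cvg; apply/norm_cvg0P.
apply: (@squeeze_cvgr _ _ _ _ (fun=> 0) (fun n => K * harmonic n)).
- by apply: nearW => n; rewrite normr_ge0 uv.
- exact: cvg_cst.
- by rewrite -[X in _ --> X](mulr0 K); apply: cvgMr; exact: cvg_harmonic.
Qed.

(** The ultralimit makes this mean exist for every bounded sequence, so no convergence of averages
    has to be proved. *)
Definition amean (R : realType) (u : nat -> R) : R :=
  ulim (fun N => N.+1%:R^-1 * \sum_(i < N.+1) u i).

Lemma avg_le (R : realType) (u : nat -> R) C N :
  (forall n, `|u n| <= C) -> `|N.+1%:R^-1 * \sum_(i < N.+1) u i| <= C.
Proof.
move=> uC; rewrite normrM gtr0_norm ?invr_gt0// mulrC ler_pdivrMr//.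
rewrite (le_trans (ler_norm_sum _ _ _))//.
have -> : C * N.+1%:R = \sum_(i < N.+1) C by rewrite sumr_const card_ord mulr_natr.
exact: ler_sum.
Qed.

Lemma bdd_avg (R : realType) (u : nat -> R) : bdd u ->
  bdd (fun N => N.+1%:R^-1 * \sum_(i < N.+1) u i).
Proof. by move=> [C uC]; exists C => N; exact: avg_le. Qed.

Lemma posfun_amean (R : realType) : posfun (@bdd R) (@amean R).
Proof.
split.
- exact: bdd_cst.
- exact: bdd_lin.
- move=> a u v bu bv; rewrite /amean -(posfun_lin (posfun_ulim R))//; try exact: bdd_avg.
  congr ulim; apply/funext => N; rewrite big_split/= -mulr_sumr; ring.
- move=> u bu u0; apply: (posfun_ge0 (posfun_ulim R)); first exact: bdd_avg.
  by move=> N; rewrite mulr_ge0// sumr_ge0.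
Qed.

Lemma amean_cst (R : realType) (c : R) : amean (fun=> c) = c.
Proof.
rewrite -[RHS]ulim_cst; congr ulim; apply/funext => N.
by rewrite sumr_const card_ord -[c *+ _]mulr_natl mulKf.
Qed.

(** The two averages share all but one term each, so they differ by O(1/N). *)
Lemma amean_shift1 (R : realType) (u : nat -> R) : bdd u ->
  amean (fun n => u n.+1) = amean u.
Proof.
move=> bu; have [C uC] := bu.
apply: (@ulim_harmonic _ _ _ (C + C)).
- exact: (bdd_avg (bdd_comp S bu)).
- exact: bdd_avg.
move=> n; rewrite -mulrBr big_ord_recr [in X in _ - X]big_ord_recl/=.
set S := \sum_(_ < _) _.
rewrite (_ : S + _ - _ = u n.+1 - u 0%N); last by ring.
rewrite normrM gtr0_norm ?invr_gt0// mulrC ler_wpM2r ?invr_ge0//.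
by rewrite (le_trans (ler_normB _ _))// lerD.
Qed.

Lemma amean_shift (R : realType) (u : nat -> R) h : bdd u ->
  amean (fun n => u (n + h)%N) = amean u.
Proof.
move=> bu; elim: h => [|h IH]; first by under eq_fun do rewrite addn0.
by under eq_fun do rewrite addnS -addSn; rewrite (@amean_shift1 _ (fun n => u (n + h)%N))//; exact: bdd_comp.
Qed.

Lemma amean_le (R : realType) (u : nat -> R) c : bdd u ->
  (forall n, u n <= c) -> amean u <= c.
Proof.
move=> bu uc; rewrite -[leRHS]amean_cst; apply: (posfun_le (posfun_amean R)) => //.
exact: bdd_cst.
Qed.

(** Expand the nonnegative mean of (u - m)^2. *)
Lemma amean_sqr (R : realType) (u : nat -> R) : bdd u ->
  amean u ^+ 2 <= amean (fun n => u n ^+ 2).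
Proof.
move=> bu; set m := amean u.
have b2 : bdd (fun n => u n ^+ 2).
  by under eq_fun do rewrite expr2; exact: bddM.
have bm : bdd (fun n => - (2 * m) * u n + m ^+ 2) by apply: bdd_lin => //; exact: bdd_cst.
have hP := posfun_amean R.
have : 0 <= amean (fun n => 1 * u n ^+ 2 + (- (2 * m) * u n + m ^+ 2)).
  apply: (posfun_ge0 hP); first exact: bdd_lin.
  move=> n; rewrite (_ : _ + _ = (u n - m) ^+ 2) ?sqr_ge0//; ring.
rewrite (posfun_lin hP)// (posfun_lin hP)//; last exact: bdd_cst.
rewrite amean_cst -/m; lra.
Qed.

(** * Positive definite functions *)

Section PosDef.
Context (R : realType) (A : zmodType).
Implicit Types (Phi Psi : A -> R) (s t : seq (R * A)) (a b m : A).

Definition pdform Phi s t : R :=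
  \sum_(x <- s) \sum_(y <- t) x.1 * y.1 * Phi (x.2 - y.2).

(** A list [s] stands for the finitely supported measure with masses [x.1] at [x.2]. Evenness is a
    separate clause because forms with real coefficients test only the even part of [Phi]. *)
Definition posdef Phi : Prop :=
  (forall a, Phi (- a) = Phi a) /\ (forall s, 0 <= pdform Phi s s).

Lemma pdformC Phi s t : posdef Phi -> pdform Phi s t = pdform Phi t s.
Proof.
move=> [ev _]; rewrite /pdform exchange_big/=.
apply: eq_bigr => x _; apply: eq_bigr => y _.
by rewrite -ev opprB [y.1 * _]mulrC.
Qed.

Lemma pdform_catl Phi s s' t :
  pdform Phi (s ++ s') t = pdform Phi s t + pdform Phi s' t.
Proof. by rewrite /pdform big_cat. Qed.

Lemma pdform_catr Phi s t t' :
  pdform Phi s (t ++ t') = pdform Phi s t + pdform Phi s t'.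
Proof.
by rewrite /pdform -big_split; apply: eq_bigr => x _; rewrite big_cat.
Qed.

Definition pdscale (c : R) s := [seq (c * x.1, x.2) | x <- s].
Definition pdshift a s := [seq (x.1, x.2 + a) | x <- s].

Lemma pdformZl Phi c s t : pdform Phi (pdscale c s) t = c * pdform Phi s t.
Proof.
rewrite /pdform big_map mulr_sumr; apply: eq_bigr => x _.
by rewrite mulr_sumr; apply: eq_bigr => y _; rewrite !mulrA.
Qed.

Lemma pdformZr Phi c s t : pdform Phi s (pdscale c t) = c * pdform Phi s t.
Proof.
rewrite /pdform mulr_sumr; apply: eq_bigr => x _.
rewrite big_map mulr_sumr; apply: eq_bigr => y _ /=; ring.
Qed.

Lemma pdform_shift Phi a s t :
  pdform Phi (pdshift a s) (pdshift a t) = pdform Phi s t.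
Proof.
rewrite /pdform big_map; apply: eq_bigr => x _.
by rewrite big_map; apply: eq_bigr => y _ /=; rewrite opprD addrACA subrr addr0.
Qed.

Lemma pdform_CS Phi s t : posdef Phi ->
  pdform Phi s t ^+ 2 <= pdform Phi s s * pdform Phi t t.
Proof.
move=> pP; have [_ pos] := pP.
set S := pdform Phi s s; set T := pdform Phi t t; set B := pdform Phi s t.
(* The form at the combination x s + y t. *)
have q (x y : R) : 0 <= x ^+ 2 * S + 2 * x * y * B + y ^+ 2 * T.
  have := pos (pdscale x s ++ pdscale y t).
  rewrite pdform_catl !pdform_catr !pdformZl !pdformZr (pdformC t s pP) -/S -/T -/B.
  by congr (_ <= _); ring.
have [T0|T0] := eqVneq T 0.
  have S0 : 0 <= S by exact: pos.
  (* With T = 0 these arguments make the form equal to - B^2. *)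
  have := q B (- (S + 1) / 2).
  rewrite T0 !mulr0 addr0 => h.
  have : 0 <= - B ^+ 2 by apply: le_trans h _; rewrite le_eqVlt; apply/orP; left; apply/eqP; field.
  by rewrite oppr_ge0.
have Tp : 0 < T by rewrite lt_def T0 pos.
have := q T (- B).
rewrite (_ : _ + _ = T * (S * T - B ^+ 2)); last by ring.
by rewrite pmulr_rge0// subr_ge0.
Qed.

Lemma posdef_ge0 Phi : posdef Phi -> 0 <= Phi 0.
Proof.
by move=> [_ /(_ [:: (1, 0)])]; rewrite /pdform !big_seq1/= !mul1r subr0.
Qed.

Lemma posdef_le Phi a : posdef Phi -> `|Phi a| <= Phi 0.
Proof.
move=> pP; rewrite -(@ler_pXn2r _ 2)// ?nnegrE ?posdef_ge0//.
have := @pdform_CS Phi [:: (1, a)] [:: (1, 0)] pP.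
by rewrite /pdform !big_seq1/= !mul1r !subrr subr0 real_normK ?num_real// -expr2.
Qed.

Lemma posdef_bdd Phi (f : nat -> A) : posdef Phi -> bdd (fun n => Phi (f n)).
Proof. by move=> pP; exists (Phi 0) => n; exact: posdef_le. Qed.

(** Cauchy-Schwarz, since translating [s] does not change its own form. *)
Lemma pdform_shift_le Phi a s : posdef Phi ->
  `|pdform Phi s (pdshift a s)| <= pdform Phi s s.
Proof.
move=> pP; have [_ pos] := pP; rewrite -(@ler_pXn2r _ 2)// ?nnegrE//.
by rewrite real_normK ?num_real// (le_trans (pdform_CS _ _ pP))// pdform_shift -expr2.
Qed.

(* The Fejer weights make this average a value of the quadratic form of [Phi],
   see [pdform_favg]; a one-sided Cesaro average need not be nonnegative. *)
Definition favg b Phi m (N : nat) : R :=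
  N.+1%:R^-1 * \sum_(i < N.+1) (N.+1%:R^-1 * \sum_(j < N.+1) Phi (m + (b *+ i - b *+ j))).

(** Acts as a projection onto the functions periodic along [b]; see [dirmean_period] and
    [dirmean_id]. *)
Definition dirmean b Phi m : R := ulim (favg b Phi m).

Lemma favg_le b Phi m N : posdef Phi -> `|favg b Phi m N| <= Phi 0.
Proof.
move=> pP; apply: (@avg_le _ (fun i : nat => N.+1%:R^-1 * \sum_(j < N.+1) Phi (m + (b *+ i - b *+ j)))) => i.
by apply: (@avg_le _ (fun j : nat => Phi (m + (b *+ i - b *+ j)))) => j; exact: posdef_le.
Qed.

Lemma bdd_favg b Phi m : posdef Phi -> bdd (favg b Phi m).
Proof. by move=> pP; exists (Phi 0) => N; exact: favg_le. Qed.

Lemma pdform_dirmean b Phi s t : posdef Phi ->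
  pdform (dirmean b Phi) s t = ulim (fun N => pdform (fun m => favg b Phi m N) s t).
Proof.
move=> pP; have hU := posfun_ulim R.
pose G (x : R * A) N := \sum_(y <- t) x.1 * y.1 * favg b Phi (x.2 - y.2) N.
have bG x : bdd (G x) by apply: (posfun_dom_sum hU) => y; exact: bdd_favg.
transitivity (\sum_(x <- s) 1 * ulim (G x)); last first.
  rewrite -(posfun_sum hU)//; congr ulim; apply/funext => N.
  by apply: eq_bigr => x _; rewrite mul1r.
apply: eq_bigr => x _; rewrite mul1r (posfun_sum hU)// => y; exact: bdd_favg.
Qed.

(** As a measure this averages the translates of [s] by 0, b, ..., N b; the differences of these
    shifts carry the Fejer weights. *)
Definition pdsmear b (N : nat) s : seq (R * A) :=
  flatten [seq pdshift (b *+ i) (pdscale N.+1%:R^-1 s) | i <- index_iota 0 N.+1].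

Lemma big_pdsmear b N s (F : R * A -> R) :
  \sum_(x <- pdsmear b N s) F x =
  \sum_(x <- s) \sum_(i < N.+1) F (N.+1%:R^-1 * x.1, x.2 + b *+ i).
Proof.
rewrite /pdsmear big_flatten big_map exchange_big big_mkord; apply: eq_bigr => i _.
by rewrite !big_map.
Qed.

Lemma pdform_favg b Phi s N :
  pdform (fun m => favg b Phi m N) s s = pdform Phi (pdsmear b N s) (pdsmear b N s).
Proof.
rewrite /pdform; set c : R := N.+1%:R^-1.
rewrite big_pdsmear; apply: eq_bigr => x _.
under [RHS]eq_bigr do rewrite big_pdsmear.
rewrite exchange_big/=; apply: eq_bigr => y _.
rewrite /favg -/c !mulr_sumr; apply: eq_bigr => i _.
rewrite !mulr_sumr; apply: eq_bigr => j _ /=.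
have -> : x.2 + b *+ i - (y.2 + b *+ j) = x.2 - y.2 + (b *+ i - b *+ j).
  by rewrite opprD addrACA.
ring.
Qed.

Lemma dirmeanN b Phi a : posdef Phi -> dirmean b Phi (- a) = dirmean b Phi a.
Proof.
move=> [ev _]; congr ulim; apply/funext => N; rewrite /favg.
under eq_bigr do rewrite mulr_sumr.
rewrite exchange_big/=; congr (_ * _); apply: eq_bigr => i _.
rewrite mulr_sumr; apply: eq_bigr => j _.
by rewrite -ev opprD opprK opprB.
Qed.

Lemma bdd_pdform_favg b Phi s t : posdef Phi ->
  bdd (fun N => pdform (fun m => favg b Phi m N) s t).
Proof.
move=> pP; have hU := posfun_ulim R; rewrite /pdform.
have -> : (fun N => \sum_(x <- s) \sum_(y <- t) x.1 * y.1 * favg b Phi (x.2 - y.2) N) =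
   (fun N => \sum_(x <- s) x.1 * \sum_(y <- t) y.1 * favg b Phi (x.2 - y.2) N).
  apply/funext => N; apply: eq_bigr => x _; rewrite mulr_sumr.
  by apply: eq_bigr => y _; rewrite mulrA.
apply: (posfun_dom_sum hU) => x; apply: (posfun_dom_sum hU) => y; exact: bdd_favg.
Qed.

Lemma posdef_dirmean b Phi : posdef Phi -> posdef (dirmean b Phi).
Proof.
move=> pP; split=> [a|s]; first exact: dirmeanN.
rewrite pdform_dirmean//; apply: (ulim_ge (n0 := 0)); last first.
  by move=> N _; rewrite pdform_favg; have [_] := pP; apply.
exact: bdd_pdform_favg.
Qed.

Lemma pdformB Phi Psi s t :
  pdform (fun m => Phi m - Psi m) s t = pdform Phi s t - pdform Psi s t.
Proof.
rewrite /pdform -sumrB; apply: eq_bigr => x _; rewrite -sumrB.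
by apply: eq_bigr => y _; rewrite mulrBr.
Qed.

Lemma pdform_mul c Phi s t :
  pdform (fun m => c * Phi m) s t = c * pdform Phi s t.
Proof.
rewrite /pdform mulr_sumr; apply: eq_bigr => x _; rewrite mulr_sumr.
by apply: eq_bigr => y _; rewrite mulrCA.
Qed.

Lemma pdform_bigsum n (F : 'I_n -> A -> R) s t :
  pdform (fun m => \sum_(i < n) F i m) s t = \sum_(i < n) pdform (F i) s t.
Proof.
rewrite /pdform [RHS]exchange_big/=; apply: eq_bigr => x _.
rewrite exchange_big/=; apply: eq_bigr => y _.
by rewrite mulr_sumr.
Qed.

(** The Fejer average is a mean of translates of [Phi], and translating one argument cannot raise
    the form. *)
Lemma pdform_favg_le b Phi s N : posdef Phi ->
  pdform (fun m => favg b Phi m N) s s <= pdform Phi s s.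
Proof.
move=> pP; set c : R := N.+1%:R^-1.
have sh (i j : nat) : pdform (fun m => Phi (m + (b *+ i - b *+ j))) s s <= pdform Phi s s.
  have := pdform_shift_le (b *+ j - b *+ i) s pP.
  rewrite ler_norml => /andP[_]; apply: le_trans; rewrite le_eqVlt; apply/orP; left; apply/eqP.
  apply: eq_bigr => x _; rewrite big_map; apply: eq_bigr => y _ /=.
  by rewrite opprD opprB !addrA.
have -> : pdform Phi s s = c * \sum_(i < N.+1) (c * \sum_(j < N.+1) pdform Phi s s).
  by rewrite !(sumr_const, card_ord) -[_ *+ _]mulr_natl mulKf// -[_ *+ _]mulr_natl mulKf.
have -> : pdform (fun m => favg b Phi m N) s s =
  c * \sum_(i < N.+1) (c * \sum_(j < N.+1) pdform (fun m => Phi (m + (b *+ i - b *+ j))) s s).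
  rewrite [LHS]pdform_mul pdform_bigsum; congr (_ * _); apply: eq_bigr => i _.
  by rewrite pdform_mul pdform_bigsum.
have c0 : 0 <= c by rewrite invr_ge0.
rewrite ler_wpM2l// ler_sum// => i _; rewrite ler_wpM2l// ler_sum//.
Qed.

(** Averaging along [b] cannot raise the form; pass to the limit. *)
Lemma posdef_sub_dirmean b Phi : posdef Phi ->
  posdef (fun m => Phi m - dirmean b Phi m).
Proof.
move=> pP; split=> [a|s]; first by rewrite dirmeanN//; have [->] := pP.
rewrite pdformB subr_ge0 pdform_dirmean// -[leRHS]ulim_cst.
apply: (posfun_le (posfun_ulim R)).
- exact: bdd_pdform_favg.
- exact: bdd_cst.
- by move=> N; exact: pdform_favg_le.
Qed.

(** Adding [b] shifts the outer index by one, which changes each average only by two boundary terms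
    of size O(1/N). *)
Lemma dirmean_period b Phi m : posdef Phi ->
  dirmean b Phi (m + b) = dirmean b Phi m.
Proof.
move=> pP; apply: (@ulim_harmonic _ _ _ (Phi 0 + Phi 0)); try exact: bdd_favg.
move=> N; set c : R := N.+1%:R^-1.
have c0 : 0 <= c by rewrite invr_ge0.
rewrite /favg -/c -mulrBr.
pose u (i : nat) := c * \sum_(j < N.+1) Phi (m + (b *+ i - b *+ j)).
have u_le i : `|u i| <= Phi 0.
  by apply: (@avg_le _ (fun j : nat => Phi (m + (b *+ i - b *+ j)))) => j; exact: posdef_le.
have -> : \sum_(i < N.+1) (c * \sum_(j < N.+1) Phi (m + b + (b *+ i - b *+ j))) =
          \sum_(i < N.+1) u i.+1.
  apply: eq_bigr => i _; congr (_ * _); apply: eq_bigr => j _; congr Phi.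
  by rewrite mulrS !addrA.
rewrite big_ord_recr [X in _ - X]big_ord_recl/= -/(u 0%N).
rewrite -[X in _ - (_ + X)]/(\sum_(i < N) u i.+1).
set S := \sum_(_ < _) u _.
rewrite (_ : S + _ - _ = u N.+1 - u 0%N); last by ring.
rewrite normrM ger0_norm// mulrC ler_wpM2r//.
by rewrite (le_trans (ler_normB _ _))// lerD.
Qed.

Lemma dirmean_id b Phi m : (forall a, Phi (a + b) = Phi a) -> dirmean b Phi m = Phi m.
Proof.
move=> per; rewrite -[RHS]ulim_cst; congr ulim; apply/funext => N.
have perD i a : Phi (a + b *+ i) = Phi a.
  by elim: i => [|i IH]; rewrite ?mulr0n ?addr0// mulrSr addrA per.
have perB j a : Phi (a - b *+ j) = Phi a by rewrite -[in LHS](perD j) subrK.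
rewrite /favg; set c : R := N.+1%:R^-1.
under eq_bigr do under eq_bigr do rewrite addrA perB perD.
rewrite !(sumr_const, card_ord) -[_ *+ _]mulr_natl mulKf//.
by rewrite -[_ *+ _]mulr_natl mulKf.
Qed.

End PosDef.

(** * Van der Corput differencing *)

Section VanDerCorput.
Context (R : realType) (A : zmodType).
Implicit Types (Psi Phi : A -> R).

(** Cauchy-Schwarz between mass [c] at each [a h] and unit mass at 0. *)
Lemma vdc_pointwise Psi (a : nat -> A) (c : R) H : posdef Psi ->
  (\sum_(h < H) c * Psi (a h)) ^+ 2 <=
  Psi 0 * \sum_(h < H) c * (\sum_(h' < H) c * Psi (a h - a h')).
Proof.
move=> pP; pose s := [seq (c, a h) | h <- index_iota 0 H].
have := pdform_CS s [:: (1, 0)] pP; rewrite /pdform !big_map !big_mkord.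
rewrite [X in _ * X]big_seq1 !big_seq1/= subrr !mul1r mulrC.
under eq_bigr do rewrite big_seq1/= mulr1 subr0.
under [X in _ <= _ * X]eq_bigr do rewrite big_map big_mkord/=.
move=> /le_trans; apply; rewrite le_eqVlt; apply/orP; left; apply/eqP.
congr (_ * _); apply: eq_bigr => i _; rewrite mulr_sumr.
by apply: eq_bigr => j _; rewrite mulrA.
Qed.

Lemma vdc Psi (v : nat -> A) H : posdef Psi ->
  amean (fun n => Psi (v n)) ^+ 2 <=
  Psi 0 * \sum_(h < H.+1) H.+1%:R^-1 * (\sum_(h' < H.+1) H.+1%:R^-1 *
     amean (fun n => Psi (v (n + h)%N - v (n + h')%N))).
Proof.
move=> pP; set c : R := H.+1%:R^-1; have hP := posfun_amean R.
have bu h : bdd (fun n => Psi (v (n + h)%N)).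
  exact: (posdef_bdd (fun n => v (n + h)%N)).
have bd h h' : bdd (fun n => Psi (v (n + h)%N - v (n + h')%N)).
  exact: (posdef_bdd (fun n => v (n + h)%N - v (n + h')%N)).
have bs (h : nat) : bdd (fun n => \sum_(h' < H.+1) c * Psi (v (n + h)%N - v (n + h')%N)).
  exact: (posfun_dom_sum hP).
(* Shift invariance replaces Psi(v(n)) by its average over H + 1 shifts. *)
have -> : amean (fun n => Psi (v n)) =
          amean (fun n => \sum_(h < H.+1) c * Psi (v (n + h)%N)).
  rewrite (posfun_sum hP)//.
  rewrite (eq_bigr (fun=> c * amean (fun n => Psi (v n)))); last first.
    move=> h _; congr (_ * _); apply: (@amean_shift _ (fun n => Psi (v n))).
    exact: posdef_bdd.
  by rewrite sumr_const card_ord -[_ *+ _]mulr_natl mulrA mulfV ?mul1r.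
apply: le_trans (amean_sqr _) _; first exact: (posfun_dom_sum hP).
have -> : Psi 0 * \sum_(h < H.+1) c * (\sum_(h' < H.+1) c *
     amean (fun n => Psi (v (n + h)%N - v (n + h')%N))) =
  amean (fun n => Psi 0 * \sum_(h < H.+1) c * (\sum_(h' < H.+1) c *
     Psi (v (n + h)%N - v (n + h')%N))).
  rewrite (posfunZ hP); last exact: (posfun_dom_sum hP).
  rewrite (posfun_sum hP)//; congr (_ * _); apply: eq_bigr => h _.
  by rewrite (posfun_sum hP).
apply: (posfun_le hP).
- under eq_fun do rewrite expr2.
  by apply: bddM; exact: (posfun_dom_sum hP).
- by apply: (posfun_domZ hP); exact: (posfun_dom_sum hP).
- by move=> n; exact: (vdc_pointwise (fun h => v (n + h)%N)).
Qed.

End VanDerCorput.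

(** * Taylor expansion and differences of integer polynomials *)

Lemma comp_poly_taylor (S : comNzRingType) (p : {poly S}) (a : S) n :
  (size p <= n)%N ->
  p \Po ('X + a%:P) = \sum_(i < n) a ^+ i *: p^`N(i).
Proof.
move=> pn; rewrite /comp_poly (@nderiv_taylor_wide _ n); last 2 first.
- exact: mulrC.
- by rewrite (leq_trans (size_poly _ _)).
apply: eq_bigr => i _; rewrite nderivn_map -[(map_poly _ _).['X]]/(_ \Po 'X).
by rewrite comp_polyXr -polyC_exp mulrC mul_polyC.
Qed.

Definition polydiff (h h' : int) (p : {poly int}) : {poly int} :=
  (p \Po ('X + h%:P)) - (p \Po ('X + h'%:P)).

Lemma horner_polydiff h h' p (x : int) : (polydiff h h' p).[x] = p.[x + h] - p.[x + h'].
Proof. by rewrite /polydiff hornerD hornerN !horner_comp !hornerE. Qed.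

Lemma coef_polydiff h h' (p : {poly int}) n k : (size p <= n)%N ->
  (polydiff h h' p)`_k =
  \sum_(i < n) (h ^+ i - h' ^+ i) * (p`_(i + k) *+ 'C(i + k, i)).
Proof.
move=> pn; rewrite /polydiff !(comp_poly_taylor _ pn) -sumrB coef_sum.
by apply: eq_bigr => i _; rewrite -scalerBl coefZ coef_nderivn.
Qed.

Lemma size_polydiff_le h h' (p : {poly int}) d :
  (size p <= d.+1)%N -> (size (polydiff h h' p) <= d)%N.
Proof.
move=> pd; apply/leq_sizeP => k dk; rewrite (coef_polydiff _ _ _ pd).
apply: big1 => -[[|i] ilt] _ /=; first by rewrite !expr0 subrr mul0r.
have -> : p`_(i.+1 + k) = 0 by apply: (leq_sizeP _ _ pd); rewrite addSn ltnS (leq_trans dk)// leq_addl.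
by rewrite mul0rn mulr0.
Qed.

(** By Taylor the coefficient of X^d is (h - h') (d + 1) times the leading coefficient of [p], hence
    nonzero. *)
Lemma size_polydiff h h' (p : {poly int}) d : h != h' ->
  size p = d.+2 -> size (polydiff h h' p) = d.+1.
Proof.
move=> hh' pd; apply/eqP; rewrite eqn_leq size_polydiff_le ?pd//=.
rewrite ltnNge; apply/negP => /leq_sizeP /(_ d (leqnn d)).
rewrite (@coef_polydiff _ _ _ d.+2) ?pd// big_ord_recl big_ord_recl big1.
  rewrite !expr0 subrr mul0r add0r addr0 /= /bump/= addn0 !expr1 add1n bin1.
  move/eqP; rewrite mulf_eq0 subr_eq0 (negPf hh')/= mulrn_eq0/=.
  by rewrite -[d.+1]/(d.+2.-1) -pd -lead_coefE lead_coef_eq0 -size_poly_eq0 pd.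
move=> i _; rewrite /= /bump/= !add1n.
by rewrite [p`_ _]nth_default ?mul0rn ?mulr0// pd !addSn !ltnS leq_addl.
Qed.

(** * Polynomial sequences in an abelian group and a Weyl-type bound *)

Section PolynomialSequences.
Context (R : realType) (A : zmodType).
Implicit Types (Psi Phi : A -> R) (s : seq (A * {poly int})).

(** Differencing acts on the integer polynomials and keeps the coefficients in [A], so this class is
    closed under van der Corput steps; constant terms are allowed. *)
Definition polyseqz s (n : nat) : A := \sum_(x <- s) x.1 *~ x.2.[n%:Z].

Definition polyseqz_diff (h h' : int) s :=
  [seq (x.1, polydiff h h' x.2) | x <- s].

Lemma polyseqz_diffE (h h' : nat) s n :
  polyseqz (polyseqz_diff h h' s) n = polyseqz s (n + h)%N - polyseqz s (n + h')%N.
Proof.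
rewrite /polyseqz big_map -sumrB; apply: eq_bigr => x _ /=.
by rewrite horner_polydiff mulrzBr !PoszD.
Qed.

Lemma le0_harmonic (x : R) : (forall n, x <= n.+1%:R^-1) -> x <= 0.
Proof.
move=> xn; have <- : ulim (@harmonic R) = 0 by apply: ulim_cvg; exact: cvg_harmonic.
rewrite -[leLHS]ulim_cst; apply: (posfun_le (posfun_ulim R)) => //; first exact: bdd_cst.
by exists 1 => n; rewrite /harmonic ger0_norm ?invr_ge0// invf_le1// ler1n.
Qed.

(* Differencing d times leaves a linear sequence whose step is a nonzero multiple
   of [b], so only the means of [Psi] along such multiples matter. *)
Lemma weyl_bound Psi b (delta : R) d (p : {poly int}) s :
  posdef Psi -> Psi 0 <= 1 -> 0 <= delta ->
  (forall k : int, k != 0 -> dirmean (b *~ k) Psi 0 <= delta ^+ (2 ^ d.+1)) ->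
  size p = d.+2 -> (forall x, x \in s -> (size x.2 <= d.+1)%N) ->
  `|amean (fun n => Psi (b *~ p.[n%:Z] + polyseqz s n))| <= delta.
Proof.
move=> pP P1; elim: d delta p s => [|d IH] delta p s d0 hb sp ss.
- rewrite -(@ler_pXn2r _ 2)// ?nnegrE// real_normK ?num_real//.
  have k0 : p`_1 != 0 by rewrite -[1%N]/(2.-1)%N -sp -lead_coefE lead_coef_eq0 -size_poly_eq0 sp.
  apply: le_trans (hb _ k0).
  have D0 : 0 <= dirmean (b *~ p`_1) Psi 0 by apply: posdef_ge0; exact: posdef_dirmean.
  apply: (@le_trans _ _ (Psi 0 * dirmean (b *~ p`_1) Psi 0)); last by rewrite ler_piMl.
  rewrite -(posfunZ (posfun_ulim R)); last exact: bdd_favg.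
  rewrite -[leLHS]ulim_cst; apply: (posfun_le (posfun_ulim R)).
  + exact: bdd_cst.
  + by apply: (posfun_domZ (posfun_ulim R)); exact: bdd_favg.
  (* Each difference is the constant (h - h') p_1 b, so the bound for [H] is [Psi 0] times a Fejer
     average along p_1 b. *)
  move=> H; apply: le_trans (vdc _ H pP) _.
  rewrite le_eqVlt; apply/orP; left; apply/eqP; congr (_ * _).
  rewrite /favg mulr_sumr; apply: eq_bigr => h _; congr (_ * _).
  rewrite mulr_sumr; apply: eq_bigr => h' _; congr (_ * _).
  rewrite -[RHS]amean_cst; congr amean; apply/funext => n; congr Psi.
  rewrite add0r opprD addrACA.
  (* At this stage [s] consists of constants, which differencing removes. *)
  have -> : polyseqz s (n + h)%N - polyseqz s (n + h')%N = 0.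
    rewrite -polyseqz_diffE /polyseqz big_map big_seq big1// => x xs /=.
    have := size_polydiff_le h h' (ss x xs).
    by rewrite leqn0 size_poly_eq0 => /eqP ->; rewrite horner0 mulr0z.
  rewrite addr0 -mulrzBr !pmulrn -!mulrzA -mulrzBr; congr (_ *~ _).
  rewrite !(@horner_coef_wide _ 2) ?sp// !big_ord_recl !big_ord0/= !PoszD; ring.
- rewrite -(@ler_pXn2r _ 2)// ?nnegrE// real_normK ?num_real// -subr_le0.
  (* The diagonal pairs h = h' cost 1 / (H + 1) in total, which vanishes as [H] grows. *)
  apply: le0_harmonic => H; rewrite lerBlDr.
  apply: le_trans (vdc _ H pP) _; set c : R := H.+1%:R^-1.
  have c0 : 0 <= c by rewrite invr_ge0.
  have HS : c * H.+1%:R = 1 by rewrite mulVf.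
  (* The diagonal uses [Psi 0 <= 1]; off it the differenced polynomial has one degree less and the
     induction applies with [delta ^+ 2], whence the exponent 2^(d+1). *)
  have aP h h' : amean (fun n => Psi (b *~ p.[(n + h)%N%:Z] + polyseqz s (n + h)%N -
       (b *~ p.[(n + h')%N%:Z] + polyseqz s (n + h')%N))) <= (h == h' :> nat)%:R + delta ^+ 2.
    have [<-|hh'] := eqVneq h h'.
      under eq_fun do rewrite subrr.
      by rewrite amean_cst (le_trans P1)// lerDl sqr_ge0.
    rewrite add0r; apply: le_trans (ler_norm _) _.
    have -> : (fun n => Psi (b *~ p.[(n + h)%N%:Z] + polyseqz s (n + h)%N -
       (b *~ p.[(n + h')%N%:Z] + polyseqz s (n + h')%N))) =
      (fun n => Psi (b *~ (polydiff h h' p).[n%:Z] + polyseqz (polyseqz_diff h h' s) n)).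
      apply/funext => n; congr Psi.
      by rewrite opprD addrACA polyseqz_diffE horner_polydiff mulrzBr !PoszD.
    apply: IH; first exact: sqr_ge0.
    + by move=> k /hb; rewrite -exprM -expnS.
    + exact: size_polydiff.
    + by move=> _ /mapP[x xs ->]; exact: size_polydiff_le (ss x xs).
  apply: (@le_trans _ _ (1 * \sum_(h < H.+1) c * (\sum_(h' < H.+1) c * ((h == h' :> nat)%:R + delta ^+ 2)))).
    have S0 : 0 <= \sum_(h < H.+1) c * (\sum_(h' < H.+1) c * ((h == h' :> nat)%:R + delta ^+ 2)).
      apply: sumr_ge0 => h _; rewrite mulr_ge0// sumr_ge0// => h' _.
      by rewrite mulr_ge0// addr_ge0// sqr_ge0.
    apply: (@le_trans _ _ (Psi 0 * \sum_(h < H.+1) c * (\sum_(h' < H.+1) c * ((h == h' :> nat)%:R + delta ^+ 2)))).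
      rewrite ler_wpM2l ?posdef_ge0// ler_sum// => h _; rewrite ler_wpM2l// ler_sum// => h' _.
      by rewrite ler_wpM2l.
    by rewrite ler_wpM2r.
  rewrite mul1r (eq_bigr (fun=> c * (c + delta ^+ 2))); last first.
    move=> h _; congr (_ * _).
    under eq_bigr do rewrite mulrDr.
    rewrite big_split/= sumr_const card_ord -[_ *+ _]mulr_natr mulrAC HS mul1r.
    congr (_ + _); rewrite (bigD1 h)//= eqxx mulr1 big1 ?addr0// => h' hh'.
    by rewrite -val_eqE/= eq_sym in hh'; rewrite (negPf hh') mulr0.
  by rewrite sumr_const card_ord -[_ *+ _]mulr_natr mulrAC HS mul1r.
Qed.

End PolynomialSequences.

(** * Means of positive definite functions along polynomial sequences *)

Section PolynomialMeans.
Context (R : realType) (A : zmodType).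
Implicit Types (Psi Phi : A -> R) (a : nat -> A).

Lemma periodz Phi (b : A) : (forall m, Phi (m + b) = Phi m) ->
  forall (k : int) m, Phi (m + b *~ k) = Phi m.
Proof.
move=> per k.
have perD (n : nat) m : Phi (m + b *+ n) = Phi m.
  by elim: n => [|n IH]; rewrite ?mulr0n ?addr0// mulrSr addrA per.
case: k => n m; first by rewrite -pmulrn perD.
by rewrite NegzE mulrNz -pmulrn -[LHS](perD n.+1) subrK.
Qed.

Lemma dirmeanB (b : A) Phi Psi m : posdef Phi -> posdef Psi ->
  dirmean b (fun x => Phi x - Psi x) m = dirmean b Phi m - dirmean b Psi m.
Proof.
move=> pPhi pPsi; rewrite -(posfunB (posfun_ulim R)); try exact: bdd_favg.
congr ulim; apply/funext => N; rewrite /favg -mulrBr -sumrB; congr (_ * _).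
by apply: eq_bigr => i _; rewrite -mulrBr -sumrB.
Qed.

(* A polynomial sequence without constant term: [a j] is the coefficient of
   n^(j+1). *)
Definition natpoly d a (n : nat) : A := \sum_(j < d) a j *+ (n ^ j.+1).

Lemma posdef_natpoly_mean d a Phi (tau : R) :
  posdef Phi -> Phi 0 <= 1 -> 0 < tau ->
  exists2 Q0 : nat, (0 < Q0)%N & forall Q : nat, (0 < Q)%N -> (Q0 %| Q)%N ->
    - tau <= amean (fun n => Phi (natpoly d a (Q * n)%N)).
Proof.
(* [Phi] splits into Phi1, periodic along a multiple of the top coefficient [b],
   and a rest Psi that has almost no mean along further multiples of [b]. *)
elim: d Phi tau => [|d IH] Phi tau pP P1 tau0.
  exists 1%N => // Q _ _; under eq_fun do rewrite /natpoly big_ord0.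
  rewrite amean_cst (@le_trans _ _ 0)// ?oppr_le0 ?posdef_ge0//; exact: ltW.
pose delta : R := tau / 2; have delta0 : 0 < delta by rewrite divr_gt0.
set b := a d.
(* A multiple [k0] that nearly attains the supremum leaves little to gain from averaging along
   further multiples. *)
pose E := [set dirmean (b *~ k) Phi 0 | k in [set k : int | k != 0]].
have Eub : ubound E 1.
  move=> _ [k _ <-]; apply: le_trans P1.
  have := posdef_ge0 (posdef_sub_dirmean (b *~ k) pP).
  by rewrite subr_ge0.
have supE : has_sup E by split; [exists (dirmean (b *~ 1) Phi 0), 1|exists 1].
have [_ [k0 /= k00 <-] supk0] := sup_adherent (exprn_gt0 (2 ^ d.+1) delta0) supE.
set b0 := b *~ k0; pose Phi1 := dirmean b0 Phi.
pose Psi m := Phi m - Phi1 m.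
have pP1 : posdef Phi1 by exact: posdef_dirmean.
have pPsi : posdef Psi by exact: posdef_sub_dirmean.
have Phi1_le : Phi1 0 <= 1 by apply: Eub; exists k0.
have Psi1 : Psi 0 <= 1 by rewrite (le_trans _ P1)// gerBl posdef_ge0.
have per : forall (k : int) m, Phi1 (m + b0 *~ k) = Phi1 m.
  by apply: periodz => m; exact: dirmean_period.
(* Averaging along multiples of [b0] fixes [Phi1], so this mean of [Psi] is at most
   [sup E - Phi1 0]. *)
have hPsi (k : int) : k != 0 -> dirmean (b0 *~ k) Psi 0 <= delta ^+ (2 ^ d.+1).
  move=> k_neq0; rewrite dirmeanB// (@dirmean_id _ _ _ Phi1); last by move=> m; exact: per.
  rewrite lerBlDr -lerBlDl; apply: le_trans (ltW supk0).
  rewrite lerB//; apply: sup_upper_bound => //.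
  by exists (k0 * k); [rewrite /= mulf_neq0|rewrite -mulrzA].
have [Q1 Q10 hQ1] := IH Phi1 delta pP1 Phi1_le delta0.
(* The factor [k0] turns the top term into a multiple of [b0]; the factor [Q1] serves the induction
   for [Phi1]. *)
exists (`|k0| * Q1)%N; first by rewrite muln_gt0 absz_gt0 k00.
move=> Q Q0 dvdQ.
have Q1Q : (Q1 %| Q)%N by apply: dvdn_trans dvdQ; exact: dvdn_mull.
have /dvdzP[k1 Qk] : (k0 %| Q%:Z)%Z.
  by rewrite dvdzE /=; apply: dvdn_trans dvdQ; exact: dvdn_mulr.
have Qz0 : Q%:Z != 0 by rewrite -lt0n.
have k10 : k1 != 0 by apply: contraNneq Qz0 => k10; rewrite Qk k10 mul0r.
have topE n : b *+ ((Q * n) ^ d.+1) = b0 *~ ((k1 * Q%:Z ^+ d) *: 'X^(d.+1) : {poly int}).[n%:Z].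
  rewrite hornerZ hornerXn /b0 -mulrzA pmulrn; congr (_ *~ _).
  rewrite -[LHS]natz natrX natrM !natz exprMn exprS {1}Qk; ring.
pose s : seq (A * {poly int}) :=
  [seq (a j, Q%:Z ^+ j.+1 *: 'X^(j.+1)) | j <- index_iota 0 d].
have lowE n : natpoly d a (Q * n)%N = polyseqz s n.
  rewrite /polyseqz big_map big_mkord; apply: eq_bigr => j _ /=.
  rewrite hornerZ hornerXn pmulrn; congr (_ *~ _).
  by rewrite -[LHS]natz natrX natrM !natz exprMn.
have hP := posfun_amean R.
(* [Phi1] does not see the top term, so it falls to the induction; [weyl_bound] handles [Psi]. *)
have -> : (fun n => Phi (natpoly d.+1 a (Q * n)%N)) =
  (fun n => Phi1 (natpoly d a (Q * n)%N) +
     Psi (b0 *~ ((k1 * Q%:Z ^+ d) *: 'X^(d.+1) : {poly int}).[n%:Z] + polyseqz s n)).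
  apply/funext => n; rewrite /natpoly big_ord_recr/= -/(natpoly d a _) topE lowE.
  set t := b0 *~ _; rewrite [t + _]addrC /Psi.
  have -> : Phi1 (polyseqz s n + t) = Phi1 (polyseqz s n) by exact: per.
  by rewrite [RHS]addrC subrK.
rewrite (posfunD hP); last 2 first.
- exact: (posdef_bdd (fun n => natpoly d a (Q * n)%N)).
- exact: (posdef_bdd (fun n => b0 *~ _ + polyseqz s n)).
have := hQ1 Q Q0 Q1Q.
have := @weyl_bound _ _ Psi b0 delta d ((k1 * Q%:Z ^+ d) *: 'X^(d.+1)) s pPsi Psi1 (ltW delta0) hPsi.
rewrite size_scale ?mulf_neq0 ?expf_neq0// size_polyXn => /(_ erefl).
have ss : forall x, x \in s -> (size x.2 <= d.+1)%N.
  move=> x /mapP[j]; rewrite mem_index_iota => /= jd ->/=.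
  by rewrite (leq_trans (size_scale_leq _ _))// size_polyXn ltnS.
move=> /(_ ss); rewrite ler_norml => /andP[hY _] hX.
by rewrite [tau]splitr opprD lerD.
Qed.

End PolynomialMeans.

(* Eventually q! is a multiple of any given modulus, which turns the
   approximate bound of [posdef_natpoly_mean] into exact nonnegativity. *)
Definition divmean (R : realType) (u : nat -> R) : R :=
  ulim (fun q => amean (fun n => u (q`! * n.+1)%N)).

Lemma bdd_amean (R : realType) (u : nat -> nat -> R) (C : R) :
  (forall q n, `|u q n| <= C) -> bdd (fun q => amean (u q)).
Proof.
move=> uC; exists C => q; have bu : bdd (u q) by exists C.
rewrite ler_norml amean_le// ?andbT; last first.
  by move=> n; rewrite (le_trans (ler_norm _)).
rewrite -[leLHS]amean_cst; apply: (posfun_le (posfun_amean R)) => //; first exact: bdd_cst.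
by move=> n; have := uC q n; rewrite ler_norml => /andP[].
Qed.

Lemma posfun_divmean (R : realType) : posfun (@bdd R) (@divmean R).
Proof.
have bd u : bdd u -> bdd (fun q => amean (fun n => u (q`! * n.+1)%N)).
  by move=> [C uC]; apply: (@bdd_amean _ _ C).
have hA := posfun_amean R.
split.
- exact: bdd_cst.
- exact: bdd_lin.
- move=> a u v bu bv; rewrite /divmean -(posfun_lin (posfun_ulim R)); try exact: bd.
  congr ulim; apply/funext => q; rewrite (posfun_lin hA)//; exact: (bdd_comp (fun n => _)).
- move=> u bu u0; apply: (posfun_ge0 (posfun_ulim R)); first exact: bd.
  by move=> q; apply: (posfun_ge0 hA) => //; exact: (bdd_comp (fun n => _)).
Qed.

Lemma divmean_cst (R : realType) (c : R) : divmean (fun=> c) = c.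
Proof. by rewrite /divmean amean_cst ulim_cst. Qed.

Lemma divmean_posdef (R : realType) (A : zmodType) (Phi : A -> R) d a :
  posdef Phi -> Phi 0 <= 1 -> 0 <= divmean (fun n => Phi (natpoly d a n)).
Proof.
move=> pP P1; apply/ler_addgt0Pl => e e0; rewrite -lerBlDl sub0r.
have [Q0 Q00 hQ] := posdef_natpoly_mean d a pP P1 e0.
have bu : bdd (fun n => Phi (natpoly d a n)) by exact: (posdef_bdd (natpoly d a)).
apply: (ulim_ge (n0 := Q0)).
  by apply: (@bdd_amean _ _ (Phi 0)) => q n; exact: posdef_le.
(* Starting at n + 1 keeps the arguments in [divmean] positive and does not affect the mean. [Q0]
   divides q! once q >= Q0. *)
move=> q qQ; rewrite (@amean_shift1 _ (fun n => Phi (natpoly d a (q`! * n)%N))).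
  by apply: hQ; rewrite ?fact_gt0// dvdn_fact// Q00.
exact: (bdd_comp (fun n => (q`! * n)%N) bu).
Qed.

(** * Functions with nonnegative moments *)

(* The weights (1 + x_j)^k have mean at least 1 and are exponentially small where
   x_j <= - eps.  The constant c depends on the number of functions only, so the
   exponent for one more function can be chosen after it. *)
Lemma nonneg_moments_large (R : realType) (J : Type) (eps : R) (l : nat) :
  0 < eps <= 1 -> exists2 c : R, 0 < c &
  forall (x : J -> nat -> R) (js : seq J) (I : (nat -> R) -> R),
    size js = l -> posfun (@bdd R) I -> (forall j n, `|x j n| <= 1) ->
    (forall w : seq J, 0 <= I (fun n => \prod_(j <- w) x j n)) ->
    c * I (fun=> 1) <= I (fun n => (all (fun j => - eps < x j n) js)%:R).
Proof.
move=> /andP[eps0 eps1]; elim: l => [|l [c c0 hc]].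
  by exists 1 => // x [|//] I _ _ _ _ /=; rewrite mul1r.
(* Where x_j <= - eps the weight (1 + x_j)^k is at most (1 - eps)^k, hence at most c / 2. *)
have [k hk] : exists k, (1 - eps) ^+ k <= c / 2.
  have : (GRing.exp (1 - eps) : nat -> R) @ \oo --> (0 : R).
    by apply: cvg_expr; rewrite ger0_norm ?subr_ge0// gtrBl.
  move=> /cvgr_le /(_ (c / 2)) []; first by rewrite divr_gt0.
  by move=> k _ /(_ k (leqnn k)) ?; exists k.
(* At most half of the mass c I(1) is lost where x_j <= - eps, and 2^k bounds the weight
   elsewhere. *)
exists (c / 2 / 2 ^+ k); first by rewrite !divr_gt0// exprn_gt0.
move=> x [//|j js] I /= [sz] hI x1 hw.
pose y n := 1 + x j n.
have y0 n : 0 <= y n by have := x1 j n; rewrite ler_norml /y => /andP[]; lra.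
have y2 n : y n <= 2 by have := x1 j n; rewrite ler_norml /y => /andP[]; lra.
have byk i : bdd (fun n => y n ^+ i).
  exists (2 ^+ i) => n; rewrite ger0_norm ?exprn_ge0//.
  by rewrite lerXn2r ?nnegrE.
have bw w : bdd (fun n => \prod_(i <- w) x i n).
  exists 1 => n; elim: w => [|i w IH]; first by rewrite big_nil normr1.
  by rewrite big_cons normrM -[leRHS]mulr1 ler_pM.
have bind js' : bdd (fun n => (all (fun i => - eps < x i n) js')%:R : R).
  by exists 1 => n; case: all; rewrite ?normr1// normr0.
(* Peeling off one factor 1 + x_j at a time writes the weighted moment as a sum of moments. *)
have hwk i w : 0 <= I (fun n => y n ^+ i * \prod_(j <- w) x j n).
  elim: i w => [|i IH] w.
    by under eq_fun do rewrite expr0 mul1r; exact: hw.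
  have -> : (fun n => y n ^+ i.+1 * \prod_(j <- w) x j n) =
     (fun n => y n ^+ i * \prod_(j <- w) x j n + y n ^+ i * \prod_(j <- j :: w) x j n).
    by apply/funext => n; rewrite big_cons exprS /y; ring.
  by rewrite (posfunD hI) ?addr_ge0//; exact: bddM.
(* Each further factor 1 + x_j adds a weighted moment, which is nonnegative. *)
have I1 : I (fun=> 1) <= I (fun n => y n ^+ k * 1).
  elim: (k) => [|i IH].
    have -> : (fun n => y n ^+ 0 * 1) = (fun=> 1) by apply/funext => n; rewrite expr0 mulr1.
    by [].
  apply: le_trans IH _.
  have -> : (fun n => y n ^+ i.+1 * 1) =
     (fun n => y n ^+ i * 1 + y n ^+ i * \prod_(j <- [:: j]) x j n).
    by apply/funext => n; rewrite big_seq1 exprS /y; ring.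
  rewrite (posfunD hI) ?lerDl//; try exact: bddM.
  by apply: bddM => //; exact: bdd_cst.
pose Ik f := I (fun n => y n ^+ k * f n).
have hIk : posfun (@bdd R) Ik.
  split.
  - exact: bdd_cst.
  - exact: bdd_lin.
  - move=> a u v bu bv; rewrite /Ik -(posfun_lin hI); try exact: bddM.
    by congr I; apply/funext => n; ring.
  - move=> u bu u0; apply: (posfun_ge0 hI); first exact: bddM.
    by move=> n; rewrite mulr_ge0// exprn_ge0.
have hc' := hc x js Ik sz hIk x1 (hwk k).
have Ile : Ik (fun n => (all (fun i => - eps < x i n) js)%:R) <=
   2 ^+ k * I (fun n => ((- eps < x j n) && all (fun i => - eps < x i n) js)%:R) +
   c / 2 * I (fun=> 1).
  rewrite -(posfun_cst hI) -(posfun_lin hI); [|exact: (bind (j :: js))|exact: bdd_cst].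
  apply: (posfun_le hI); first exact: bddM.
    by apply: bdd_lin; [exact: (bind (j :: js))|exact: bdd_cst].
  move=> n; case: all; rewrite ?andbT ?andbF ?mulr0 ?mulr1; last first.
    by rewrite add0r divr_ge0// ltW.
  case: ltP => xj /=; rewrite ?mulr1 ?mulr0 ?add0r.
    apply: (@le_trans _ _ (2 ^+ k)); first by rewrite lerXn2r ?nnegrE.
    by rewrite lerDl divr_ge0// ltW.
  apply: le_trans hk; rewrite lerXn2r ?nnegrE// ?subr_ge0//.
  by rewrite /y; lra.
have h2 : 0 < (2 : R) ^+ k by rewrite exprn_gt0.
rewrite mulrAC ler_pdivrMr// [leRHS]mulrC.
have c1 : c * I (fun=> 1) <= c * Ik (fun=> 1) by rewrite ler_wpM2l// ltW.
have := le_trans (le_trans c1 hc') Ile.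
by rewrite -lerBlDr -mulrBl [c in c - _]splitr addrK.
Qed.

(** [K] is a Gram kernel, so the form of the product is [I] applied to the form of [Phi] with
    coefficients multiplied by [g x.2 v]. *)
Lemma posdef_schur (R : realType) (A : zmodType) (Phi K : A -> R)
    (V : Type) (D : (V -> R) -> Prop) (I : (V -> R) -> R) (g : A -> V -> R) :
  posfun D I -> (forall a b, D (fun v => g a v * g b v)) ->
  (forall a b, K (a - b) = I (fun v => g a v * g b v)) ->
  posdef Phi -> posdef (fun a => Phi a * K a).
Proof.
move=> hI Dg KE [ev pos]; split.
  move=> a; rewrite ev; congr (_ * _).
  rewrite -[- a]sub0r -{2}[a]subr0 !KE; congr I; apply/funext => v.
  exact: mulrC.
move=> s; pose F x v := \sum_(y <- s) x.1 * y.1 * Phi (x.2 - y.2) * (g x.2 v * g y.2 v).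
have DF x : D (F x) by exact: (posfun_dom_sum hI).
have -> : pdform (fun a => Phi a * K a) s s = \sum_(x <- s) 1 * I (F x).
  apply: eq_bigr => x _; rewrite mul1r (posfun_sum hI)//.
  by apply: eq_bigr => y _; rewrite mulrA KE.
rewrite -(posfun_sum hI)//; apply: (posfun_ge0 hI).
  exact: (posfun_dom_sum hI).
move=> v; have := pos [seq (x.1 * g x.2 v, x.2) | x <- s].
rewrite /pdform big_map; under eq_bigr do rewrite big_map/=.
congr (_ <= _); apply: eq_bigr => x _; rewrite mul1r; apply: eq_bigr => y _.
ring.
Qed.

Lemma posdef1 (R : realType) (A : zmodType) : posdef (fun _ : A => 1 : R).
Proof.
split=> // s; rewrite /pdform.
have -> : \sum_(x <- s) \sum_(y <- s) x.1 * y.1 * 1 = (\sum_(x <- s) x.1 : R) ^+ 2.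
  rewrite expr2 mulr_suml; apply: eq_bigr => x _; rewrite mulr_sumr.
  by apply: eq_bigr => y _; rewrite mulr1.
exact: sqr_ge0.
Qed.

(** * Correlations of an invertible system *)

Section BoundedIntegral.
Context (R : realType) (d : measure_display) (X : measurableType d).
Context (mu : probability X R).

Definition bddmeas (u : X -> R) : Prop :=
  measurable_fun setT u /\ exists C : R, forall x, `|u x| <= C.

Lemma bddmeas_integrable u : bddmeas u -> mu.-integrable setT (EFin \o u).
Proof.
move=> [mu_ [C uC]]; apply: measurable_bounded_integrable => //.
  exact: le_lt_trans (probability_le1 mu measurableT) (ltry 1).
exists C; split; first exact: num_real.
by move=> M CM x _ /=; apply: le_trans (uC x) (ltW CM).
Qed.

Lemma posfun_Rintegral : posfun bddmeas (fun u => \int[mu]_(x in setT) u x).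
Proof.
have Dlin a u v : bddmeas u -> bddmeas v -> bddmeas (fun x => a * u x + v x).
  move=> [mu_ [C uC]] [mv [K vK]]; split.
    by apply: measurable_funD => //; exact: measurable_funM.
  exists (`|a| * C + K) => x.
  by rewrite (le_trans (ler_normD _ _))// lerD// normrM ler_wpM2l.
have D1 : bddmeas (fun=> 1) by split=> //; exists 1 => x; rewrite normr1.
split => //.
- move=> a u v Du Dv.
  have Dau : bddmeas (fun x => a * u x).
    have D0 : bddmeas (fun=> 0) by split=> //; exists 0 => x; rewrite normr0.
    by have := Dlin a u _ Du D0; under eq_fun do rewrite addr0.
  rewrite RintegralD//; try exact: bddmeas_integrable.
  by rewrite RintegralZl//; exact: bddmeas_integrable.
- by move=> u _ u0; apply: Rintegral_ge0.
Qed.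

Lemma bddmeas_indic (B : set X) : measurable B -> bddmeas (\1_B : X -> R).
Proof.
move=> mB; split; first exact: measurable_indic.
by exists 1 => x; rewrite indicE; case: (x \in B); rewrite ?normr1 ?normr0.
Qed.

Lemma Rintegral_indic (B : set X) : measurable B ->
  \int[mu]_(x in setT) (\1_B x : R) = fine (mu B).
Proof. by move=> mB; rewrite /Rintegral integral_indic// setIT. Qed.

End BoundedIntegral.

Section Iterates.
Context (R : realType) (d : measure_display) (X : measurableType d).
Context (mu : probability X R) (T Tinv : X -> X).
Context (hT : invertible_mps mu T Tinv).

Lemma iterz_succ m x : iterz T Tinv (m + 1) x = T (iterz T Tinv m x).
Proof.
case: m => [n|[|n]].
- by rewrite -PoszD addn1.
- by rewrite /= (mpsVK hT).
- rewrite (_ : Negz n.+1 + 1 = Negz n); last by rewrite !NegzE; lia.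
  by rewrite /= (mpsVK hT).
Qed.

Lemma iterzD m k x : iterz T Tinv (m + k) x = iterz T Tinv m (iterz T Tinv k x).
Proof.
elim/int_rect: m => [|n IH|n IH]; first by rewrite add0r.
- by rewrite -addn1 PoszD addrAC !iterz_succ IH.
(* For negative exponents, applying the injective [T] to both sides leads back to - n. *)
- apply: (can_inj (mpsK hT)); rewrite -!iterz_succ.
  rewrite (_ : - n.+1%:Z + k + 1 = - n%:Z + k); last by rewrite -addn1; lia.
  by rewrite IH (_ : - n.+1%:Z + 1 = - n%:Z)//; lia.
Qed.

Lemma measurable_iterz m : measurable_fun setT (iterz T Tinv m).
Proof.
have it (f : X -> X) n : measurable_fun setT f -> measurable_fun setT (iter n f).
  move=> mf; elim: n => [|n IH]; first exact: measurable_id.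
  exact: (measurableT_comp mf IH).
by case: m => n; apply: it; [exact: mps_measurable hT|exact: mpsV_measurable hT].
Qed.

Lemma measurable_iterz_preimage m (B : set X) : measurable B ->
  measurable (iterz T Tinv m @^-1` B).
Proof. by move=> mB; rewrite -[X in measurable X]setTI; exact: measurable_iterz. Qed.

Lemma iterz_preserving m (B : set X) : measurable B ->
  mu (iterz T Tinv m @^-1` B) = mu B.
Proof.
have succ k : measurable B ->
    mu (iterz T Tinv (k + 1) @^-1` B) = mu (iterz T Tinv k @^-1` B).
  move=> mB; rewrite -[RHS](mps_preserving hT); last exact: measurable_iterz_preimage.
  congr (mu _); apply/funext => x /=.
  by rewrite iterzD.
move=> mB; elim/int_rect: m => [|n IH|n IH]; first by [].
- by rewrite -addn1 PoszD succ.
- by rewrite -succ// (_ : - n.+1%:Z + 1 = - n%:Z)//; lia.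
Qed.

Context (A : set X) (mA : measurable A).

Definition autocorr (m : int) : R :=
  fine (mu (A `&` iterz T Tinv m @^-1` A)) - fine (mu A) ^+ 2.

(** The vectors whose Gram matrix is given by [autocorr]; subtracting the mean yields the term -
    mu(A)^2. *)
Definition recentred (m : int) (x : X) : R :=
  \1_(iterz T Tinv m @^-1` A) x - fine (mu A).

Let mB m : measurable (iterz T Tinv m @^-1` A).
Proof. exact: measurable_iterz_preimage. Qed.

Lemma bddmeas_recentred m k : bddmeas (fun x => recentred m x * recentred k x).
Proof.
have hI := posfun_Rintegral mu.
have b j : bddmeas (recentred j).
  apply: (posfun_domB hI); first exact: bddmeas_indic.
  exact: (posfun_dom_cst hI).
have [m1 [C hC]] := b m; have [m2 [K hK]] := b k.
split; first exact: measurable_funM.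
by exists (C * K) => x; rewrite normrM ler_pM.
Qed.

(** After expanding, invariance under T^k moves the pair of times (m, k) to (m - k, 0). *)
Lemma autocorrE m k :
  autocorr (m - k) = \int[mu]_(x in setT) (recentred m x * recentred k x).
Proof.
have hI := posfun_Rintegral mu; set a := fine (mu A).
pose B j := iterz T Tinv j @^-1` A.
have -> : (fun x => recentred m x * recentred k x) =
   (fun x => - a * \1_(B m) x + (- a * \1_(B k) x + (\1_(B m `&` B k) x + a ^+ 2))).
  by apply/funext => x; rewrite /recentred -/a -/(B m) -/(B k) indicI /=; ring.
have Dc := posfun_dom_cst hI (a ^+ 2).
have Di j : bddmeas (\1_(B j) : X -> R) by exact: (bddmeas_indic R (mB j)).
have mI : measurable (B m `&` B k) := measurableI _ _ (mB m) (mB k).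
have Dmk : bddmeas (fun x => \1_(B m `&` B k) x + a ^+ 2 : R).
  apply: (posfun_domD hI) => //; exact: bddmeas_indic.
rewrite (posfun_lin hI)//; last exact: (posfun_dom hI).
rewrite (posfun_lin hI)// (posfunD hI)//; last exact: bddmeas_indic.
rewrite (posfun_cst hI) !Rintegral_indic/=; [|exact: mI|exact: mB|exact: mB].
have int1 : \int[mu]_(x in setT) (1 : R) = 1.
  by rewrite Rintegral_cst// mul1r -[RHS]/(fine 1%E); congr fine; exact: probability_setT.
rewrite int1 mulr1.
rewrite /B !iterz_preserving// -/a.
rewrite /autocorr -/a -(@iterz_preserving k (A `&` _)); last exact: measurableI.
rewrite preimage_setI [_ `&` _]setIC.
have -> : iterz T Tinv k @^-1` (iterz T Tinv (m - k) @^-1` A) = iterz T Tinv m @^-1` A.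
  by apply/funext => x /=; rewrite -iterzD subrK.
ring.
Qed.

Lemma autocorr_le1 m : `|autocorr m| <= 1.
Proof.
have P (B : set X) : measurable B -> 0 <= fine (mu B) <= 1.
  move=> mB0; rewrite fine_ge0//= -[leRHS]/(fine 1%:E).
  by rewrite fine_le// ?probability_le1// fin_num_measure.
have /andP[h1 h2] := P _ mA; have /andP[h3 h4] := P _ (measurableI _ _ mA (mB m)).
rewrite /autocorr ler_norml; apply/andP; split; nra.
Qed.

(** A list may repeat indices, so these give all mixed moments; working on Z^l turns the tuple of
    the P_i into one sequence. *)
Definition autocorr_prod (l : nat) (w : seq 'I_l) (m : 'rV[int]_l) : R :=
  \prod_(i <- w) autocorr (m 0 i).

(** Induction by Schur products, with Gram vectors [recentred (m 0 i)]. *)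
Lemma posdef_autocorr_prod l (w : seq 'I_l) : posdef (autocorr_prod w).
Proof.
elim: w => [|i w IH].
  have -> : autocorr_prod [::] = (fun _ : 'rV[int]_l => 1) by apply/funext => m; rewrite /autocorr_prod big_nil.
  exact: posdef1.
have -> : autocorr_prod (i :: w) = (fun m => autocorr_prod w m * autocorr (m 0 i)).
  by apply/funext => m; rewrite /autocorr_prod big_cons mulrC.
apply: (posdef_schur (g := fun m : 'rV[int]_l => recentred (m 0 i)) (posfun_Rintegral mu)) => //.
- by move=> a b; exact: bddmeas_recentred.
- by move=> a b; rewrite !mxE autocorrE.
Qed.

End Iterates.

Theorem theorem1p1 (R : realType) (d : measure_display) (X : measurableType d)
    (mu : probability X R) (T Tinv : X -> X) (hT : invertible_mps mu T Tinv)
    (l : nat) (P : 'I_l -> {poly int}) (hP : forall i : 'I_l, (P i).[0] = 0)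
    (A : set X) (hA : measurable A) (eps : R) (heps : 0 < eps) :
  exists n : nat, (0 < n)%N /\
    forall i : 'I_l,
      (mu A ^+ 2 - eps%:E
        < mu (A `&` (iterz T Tinv ((P i).[n%:Z])) @^-1` A))%E.
Proof.
(* [nonneg_moments_large] asks for a threshold of at most 1. *)
pose e := Num.min eps 1.
have e01 : 0 < e <= 1 by rewrite lt_min heps ltr01 ge_min lexx orbT.
pose x (i : 'I_l) (n : nat) := autocorr mu T Tinv A ((P i).[n%:Z]).
(* [D] bounds all the degrees; coefficients beyond a degree default to 0, and P_i(0) = 0 removes the
   constant term, which [natpoly] lacks. *)
pose D := (\max_(i < l) size (P i))%N.
pose a (j : nat) : 'rV[int]_l := \row_i (P i)`_j.+1.
have aE n i : (natpoly D a n) 0 i = (P i).[n%:Z].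
  rewrite summxE (@horner_coef_wide _ D.+1); last first.
    by rewrite ltnW// ltnS (leq_bigmax i).
  rewrite big_ord_recl -horner_coef0 hP mul0r add0r; apply: eq_bigr => j _.
  rewrite mulmxnE mxE -mulr_natr natrX natz; congr (_ * _).
have [c c0 /(_ x (enum 'I_l) (@divmean R))] := @nonneg_moments_large R 'I_l e l e01.
rewrite size_enum_ord divmean_cst mulr1 => hc.
have {}hc : c <= divmean (fun n => (all (fun j => - e < x j n) (enum 'I_l))%:R).
  apply: hc => //; first exact: posfun_divmean.
    by move=> j n; exact: autocorr_le1.
  move=> w; have -> : (fun n => \prod_(j <- w) x j n) =
      (fun n => autocorr_prod mu T Tinv A w (natpoly D a n)).
    by apply/funext => n; apply: eq_bigr => j _; rewrite aE.
  apply: divmean_posdef; first exact: posdef_autocorr_prod.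
  rewrite /autocorr_prod (le_trans (ler_norm _))// normr_prod.
  elim: w => [|i w IH]; first by rewrite big_nil.
  by rewrite big_cons -[leRHS]mulr1 ler_pM//; [exact: prodr_ge0|exact: (autocorr_le1 hT)].
(* Otherwise the indicator vanishes at every q! (n + 1), so its mean is 0, against c > 0. *)
have [n n0 /allP nP] : exists2 n, (0 < n)%N & all (fun j => - e < x j n) (enum 'I_l).
  apply: contrapT => no; move: hc; rewrite leNgt => /negP; apply.
  rewrite (_ : divmean _ = 0)//.
  rewrite -[RHS](@ulim_cst R 0); congr ulim; apply/funext => q.
  rewrite -[RHS](@amean_cst R 0); congr amean; apply/funext => n.
  case: (boolP (all _ _)) => [h|//]; case: no; exists (q`! * n.+1)%N => //.
  by rewrite muln_gt0 fact_gt0.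
exists n; split => // i; have := nP i (mem_enum _ i).
rewrite /x /autocorr.
have mI : measurable (A `&` iterz T Tinv (P i).[n%:Z] @^-1` A).
  by apply: measurableI => //; exact: (measurable_iterz_preimage hT).
rewrite -[mu A]fineK ?fin_num_measure// -[mu (A `&` _)]fineK ?fin_num_measure//.
rewrite -EFin_expe -EFinB lte_fin/= => h.
have : e <= eps by rewrite ge_min lexx.
lra.
Qed.
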